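(* Let $P\subset\mathbb{R}^d$ be a full-dimensional centrally symmetric polytope containing the origin in its interior, and let $\Delta$ be a polyhedral fan that is the bisection fan of $P$. Then both $\mathcal{H}_P$ and $\mathcal{F}_P$ are refined by $\Delta$.
   Context: $P=-P$. Its distance function is $\operatorname{dist}(a,b)=\min\{\alpha\ge 0 : b-a\in\alpha P\}$. For $a,b\in\mathbb{R}^d$ the bisector is $\operatorname{bis}(a,b)=\{x\in\mathbb{R}^d:\operatorname{dist}(a,x)=\operatorname{dist}(b,x)\}$. For a face $F$ of $P$, $C_F=\operatorname{cone}(F)$ is the set of all finite nonnegative linear combinations of points of $F$. For facets $F,G$, $\operatorname{bis}_{F,G}(a,b)=\operatorname{bis}(a,b)\cap(C_F+a)\cap(C_G+b)$. Two bisectors $\operatorname{bis}(a,b)$ and $\operatorname{bis}(a',b')$ are equivalent if for all facets $F,G$ of $P$: $\operatorname{bis}_{F,G}(a,b)\ne\emptyset \Leftrightarrow \operatorname{bis}_{F,G}(a',b')\neq\emptyset$. A point $c\in\mathbb{R}^d$ is in general position if there is a neighborhood $U$ of $c$ such that $\operatorname{bis}(0,c)$ is equivalent to $\operatorname{bis}(0,c')$ for all $c'\in U$. A polyhedral fan $\Delta$ is the bisection fan of $P$ if for all $a,b\in\mathbb{R}^d$ in general position the following are equivalent: (i) $\operatorname{bis}(0,a)$ and $\operatorname{bis}(0,b)$ are equivalent; (ii) $a$ and $b$ lie in the interior of the same maximal cone of $\Delta$. $\mathcal{H}_P$ is the arrangement of all hyperplanes through the origin parallel to a facet of $P$, and also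 denotes the fan induced by this arrangement. $\mathcal{F}_P=\{C_F: F\subsetneq P \text{ a face}\}$ is the face fan of $P$. A fan is refined by $\Delta$ if every cone of $\Delta$ is contained in some cone of it. *)

(* Defs.v *)
From HB Require Import structures.
From mathcomp Require Import all_boot all_order all_algebra.
From mathcomp Require Import all_classical all_reals all_analysis.
Set Implicit Arguments.
Unset Strict Implicit.
Unset Printing Implicit Defensive.
Import Order.TTheory GRing.Theory Num.Theory.
Import numFieldNormedType.Exports.
Local Open Scope classical_set_scope.
Local Open Scope ring_scope.

(* Points of R^d are row vectors, with the topology of matrix_topology
   (the product topology), which is available for every d : nat. *)

Section Defs.
Variables (R : realType) (d : nat).
Local Notation V := 'rV[R]_d.
Implicit Types (A B P F G C : set V) (a b c u x : V).
Implicit Types (Delta S AA : set (set V)).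

Definition dot u x : R := \sum_i u 0 i * x 0 i.

Definition conv A : set V :=
  [set x | exists n (v : 'I_n -> V) (l : 'I_n -> R),
    [/\ forall i, A (v i), forall i, 0 <= l i, \sum_i l i = 1
      & x = \sum_i l i *: v i]].

(* The empty combination (n = 0) is allowed, so that cone set0 = [set 0]. *)
Definition cone A : set V :=
  [set x | exists n (v : 'I_n -> V) (l : 'I_n -> R),
    [/\ forall i, A (v i), forall i, 0 <= l i
      & x = \sum_i l i *: v i]].

Definition aff A : set V :=
  [set x | exists n (v : 'I_n -> V) (l : 'I_n -> R),
    [/\ forall i, A (v i), \sum_i l i = 1
      & x = \sum_i l i *: v i]].

(* The empty set has no dimension in this sense. *)
Definition has_dim A (k : nat) : Prop :=
  exists x0 (U : {vspace V}),
    aff A = [set x0 + u | u in [set u | u \in U]] /\ \dim U = k.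

Definition polytope P : Prop := exists2 A, finite_set A & P = conv A.

Definition full_dimensional P : Prop := has_dim P d.

Definition centrally_symmetric P : Prop := [set - x | x in P] = P.

(* Faces of a polytope or of a polyhedral cone. The choice u = 0 gives the
   two trivial faces, set0 and the polyhedron itself. *)
Definition face A F : Prop :=
  exists u (beta : R),
    (forall x, A x -> dot u x <= beta) /\ F = A `&` [set x | dot u x = beta].

Definition facet P F : Prop :=
  face P F /\ exists2 k, has_dim F k & has_dim P k.+1.

(* When P is a polytope with 0 in its interior, this infimum is a minimum. *)
Definition dist P a b : R :=
  inf [set alpha : R | 0 <= alpha /\ [set alpha *: p | p in P] (b - a)].

Definition bis P a b : set V := [set x | dist P a x = dist P b x].

Definition translate A a : set V := [set x + a | x in A].

Definition bis_facets P F G a b : set V :=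
  bis P a b `&` translate (cone F) a `&` translate (cone G) b.

Definition bis_equiv P a b a' b' : Prop :=
  forall F G, facet P F -> facet P G ->
    (bis_facets P F G a b !=set0 <-> bis_facets P F G a' b' !=set0).

Definition general_position P c : Prop :=
  exists2 U : set V, nbhs c U & forall c', U c' -> bis_equiv P 0 c 0 c'.

Definition polyhedral_cone C : Prop :=
  exists2 N : set V, finite_set N & C = [set x | forall u, N u -> 0 <= dot u x].

(* Cones of a fan need not be pointed, and a fan need not be complete. *)
Definition polyhedral_fan Delta : Prop :=
  [/\ finite_set Delta,
      forall C, Delta C -> polyhedral_cone C,
      forall C F, Delta C -> face C F -> F !=set0 -> Delta F
    & forall C D, Delta C -> Delta D ->
        face C (C `&` D) /\ face D (C `&` D)].

Definition maximal_cone Delta C : Prop :=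
  Delta C /\ forall D, Delta D -> C `<=` D -> D = C.

Definition bisection_fan P Delta : Prop :=
  polyhedral_fan Delta /\
  forall a b, general_position P a -> general_position P b ->
    (bis_equiv P 0 a 0 b <->
     exists C, [/\ maximal_cone Delta C, interior C a & interior C b]).

Definition hyperplane u : set V := [set x | dot u x = 0].

(* A linear hyperplane is parallel to F when it contains all differences of
   points of F, i.e. when F lies in a translate of it. *)
Definition facet_arrangement P : set (set V) :=
  [set H | exists u F, [/\ u != 0, H = hyperplane u, facet P F
    & forall x y, F x -> F y -> H (x - y)]].

(* The points lying, for each hyperplane of AA, on the same side as x, or on
   the hyperplane if x does. *)
Definition cell AA x : set V :=
  [set y | forall u, AA (hyperplane u) ->
    Num.sg (dot u y) = Num.sg (dot u x)].

Definition arrangement_fan AA : set (set V) :=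
  [set closure (cell AA x) | x in setT].

Definition facet_hyperplane_fan P : set (set V) :=
  arrangement_fan (facet_arrangement P).

Definition face_fan P : set (set V) :=
  [set cone F | F in [set F | face P F /\ F `<` P]].

Definition refined_by S Delta : Prop :=
  forall C, Delta C -> exists2 D, S D & C `<=` D.

End Defs.

(* Main.v *)
(* For facets F and G, bis_{F,G}(0,c) is nonempty iff c lies in the cone
   K_{F,G} = {t(p - q) : t >= 0, p in F, q in G}, because the gauge of P takes
   the value t on tF. Two choices of G recover the two fans. By central
   symmetry -F is a facet, and K_{F,-F} = cone(F), so the class of bis(0,c)
   determines the facet cones containing c. If u is the normal of F, then K_{F,G}
   lies in the half-space u >= 0 for every G, and conversely every c with
   u.c > 0 lies in some K_{F,G}; applied to F and -F this shows that the class
   determines on which side of the hyperplane u = 0 the point c lies.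
   The cones K_{F,G} are finitely generated, hence closed, and there are
   finitely many of them, so points in general position are dense. Therefore
   every cone of the bisection fan lies in a maximal one with interior, which is
   the closure of mutually equivalent points in general position. *)

Require Import Defs.
From HB Require Import structures.
From mathcomp Require Import all_boot all_order all_algebra.
From mathcomp Require Import all_classical all_reals all_analysis.
From mathcomp Require Import zify ring lra.
Set Implicit Arguments.
Unset Strict Implicit.
Unset Printing Implicit Defensive.
Import Order.TTheory GRing.Theory Num.Theory.
Import numFieldNormedType.Exports.
Local Open Scope classical_set_scope.
Local Open Scope ring_scope.
(* The analysis library has another conv. *)
Local Notation conv := Defs.conv.

(** * The bilinear form [dot] *)

Section Dot.
Variables (R : realType) (d : nat).
Implicit Types (u w x y : 'rV[R]_d) (k : R).

Lemma dotC u x : dot u x = dot x u.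
Proof. by apply: eq_bigr => i _; rewrite mulrC. Qed.

Lemma dotE u x : dot u x = (x *m u^T) 0 0.
Proof. by rewrite mxE; apply: eq_bigr => i _; rewrite mxE mulrC. Qed.

Lemma dotDr u x y : dot u (x + y) = dot u x + dot u y.
Proof. by rewrite !dotE mulmxDl mxE. Qed.

Lemma dotZr u k x : dot u (k *: x) = k * dot u x.
Proof. by rewrite !dotE -scalemxAl mxE. Qed.

Lemma dotNr u x : dot u (- x) = - dot u x.
Proof. by rewrite -scaleN1r dotZr mulN1r. Qed.

Lemma dot0r u : dot u 0 = 0.
Proof. by rewrite -(scale0r 0) dotZr mul0r. Qed.

Lemma dotDl u w x : dot (u + w) x = dot u x + dot w x.
Proof. by rewrite dotC dotDr !(dotC x). Qed.

Lemma dotZl k u x : dot (k *: u) x = k * dot u x.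
Proof. by rewrite dotC dotZr (dotC x). Qed.

Lemma dotNl u x : dot (- u) x = - dot u x.
Proof. by rewrite dotC dotNr (dotC x). Qed.

Lemma dot0l x : dot 0 x = 0.
Proof. by rewrite dotC dot0r. Qed.

Lemma dot_sumr u n (v : 'I_n -> 'rV[R]_d) (l : 'I_n -> R) :
  dot u (\sum_i l i *: v i) = \sum_i l i * dot u (v i).
Proof.
rewrite (big_morph (dot u) (dotDr u) (dot0r u)).
by apply: eq_bigr => i _; rewrite dotZr.
Qed.

Lemma dot_gt0 x : x != 0 -> 0 < dot x x.
Proof.
move=> x0; rewrite lt0r sumr_ge0 ?andbT; last by move=> i _; exact: sqr_ge0.
apply: contra x0; rewrite psumr_eq0 => [|i _]; last exact: sqr_ge0.
move=> /allP h; apply/eqP/rowP => i; rewrite mxE.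
by have /implyP/(_ isT) := h i (mem_index_enum i);
  rewrite mulf_eq0 orbb => /eqP.
Qed.

Lemma dot_eq0P x : (forall y, dot x y = 0) -> x = 0.
Proof.
by move=> h; apply/eqP; apply: contraTT isT => /dot_gt0; rewrite h ltxx.
Qed.

Lemma dot_delta (i : 'I_d) x : dot (delta_mx 0 i) x = x 0 i.
Proof.
rewrite /dot (bigD1 i) //= mxE !eqxx mul1r big1 ?addr0 // => j ji.
by rewrite mxE eqxx (negPf ji) mul0r.
Qed.

End Dot.

(** * Finitely generated cones as intersections of half-spaces *)

Lemma seq_argmin (R : realType) (T : eqType) (f : T -> R) (s : seq T) :
  s != [::] -> exists2 t, t \in s & forall r, r \in s -> f t <= f r.
Proof.
elim: s => // a s IH _; have [->|/IH[t ts ht]] := eqVneq s [::].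
  by exists a; rewrite ?mem_head // => r; rewrite inE => /eqP ->.
have [fa|fa] := leP (f a) (f t).
  exists a; rewrite ?mem_head // => r; rewrite inE => /predU1P[->//|/ht].
  exact: le_trans.
exists t; rewrite ?inE ?ts ?orbT // => r.
by rewrite inE => /predU1P[->|/ht//]; exact: ltW.
Qed.

Section Cone.
Variables (R : realType) (d : nat).
Local Notation V := 'rV[R]_d.
Implicit Types (A K : set V) (u w x y a : V) (N s : seq V) (k t : R).

Lemma cone0 A : cone A 0.
Proof.
exists 0%N, (fun=> 0), (fun=> 0); split=> [[]//|[]//|].
by rewrite big_ord0.
Qed.

Lemma coneZ A k x : 0 <= k -> cone A x -> cone A (k *: x).
Proof.
move=> k0 [n [v [l [Av l0 ->]]]]; exists n, v, (fun i => k * l i).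
split=> // [i|]; first exact: mulr_ge0.
by rewrite scaler_sumr; apply: eq_bigr => i _; rewrite scalerA.
Qed.

Lemma coneD A x y : cone A x -> cone A y -> cone A (x + y).
Proof.
move=> [n [v [l [Av l0 ->]]]] [m [v' [l' [Av' l0' ->]]]].
exists (n + m)%N,
  (fun i => match fintype.split i with inl j => v j | inr j => v' j end),
  (fun i => match fintype.split i with inl j => l j | inr j => l' j end).
split=> [i|i|]; [by case: fintype.split | by case: fintype.split |].
rewrite big_split_ord /=; congr +%R; apply: eq_bigr => i _.
  by case: splitP => [j /= /val_inj ->//|j /= e];
    have := ltn_ord i; rewrite e ltnNge leq_addr.
case: splitP => [j /= e|j /= /addnI/val_inj -> //].
by have := ltn_ord j; rewrite -e ltnNge leq_addr.
Qed.

Lemma sub_cone A : A `<=` cone A.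
Proof.
move=> x Ax; exists 1%N, (fun=> x), (fun=> 1); split=> //.
by rewrite big_ord1 scale1r.
Qed.

Lemma cone_min A K : K 0 -> (forall x y, K x -> K y -> K (x + y)) ->
  (forall k x, 0 <= k -> K x -> K (k *: x)) -> A `<=` K -> cone A `<=` K.
Proof.
move=> K0 KD KZ AK x [n [v [l [Av l0 ->]]]].
by apply: (big_ind K) => // i _; apply: KZ => //; exact: AK.
Qed.

Definition halfspaces N : set V := [set x | forall u, u \in N -> 0 <= dot u x].

(* Fourier-Motzkin elimination of the coefficient of the generator a. *)
Lemma finite_cone_halfspaces s :
  exists N, cone [set` s] = halfspaces N.
Proof.
elim: s => [|a s [N sN]].
  (* The cone {0} is cut out by x_i >= 0 and -x_i >= 0. *)
  exists ([seq delta_mx 0 i | i : 'I_d] ++ [seq - delta_mx 0 i | i : 'I_d]).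
  apply/seteqP; split => [|x hx].
    apply: cone_min => [u _|x y hx hy u uN|k x k0 hx u uN|//].
    - by rewrite dot0r.
    - by rewrite dotDr addr_ge0 ?hx ?hy.
    - by rewrite dotZr mulr_ge0 ?hx.
  suff -> : x = 0 by exact: cone0.
  apply/rowP => i; rewrite mxE; apply/le_anti/andP; split.
    rewrite -oppr_ge0 -dot_delta -dotNl hx // mem_cat; apply/orP; right.
    by exact: codom_f.
  rewrite -dot_delta hx // mem_cat; apply/orP; left.
  by exact: codom_f.
(* If u.a > 0 > w.a, then [f u w] is a positive combination of u and w that vanishes at [a]. *)
pose f u w : V := dot u a *: w - dot w a *: u.
exists ([seq u <- N | 0 <= dot u a] ++
  [seq f u w | u <- [seq u <- N | 0 < dot u a],
               w <- [seq w <- N | dot w a < 0]]).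
apply/seteqP; split => [|x hx].
  apply: cone_min => [u _|x y hx hy u uN|k x k0 hx u uN|x /= xs u].
  - by rewrite dot0r.
  - by rewrite dotDr addr_ge0 ?hx ?hy.
  - by rewrite dotZr mulr_ge0 ?hx.
  have {xs} : x = a \/ forall v, v \in N -> 0 <= dot v x.
    move: xs; rewrite inE => /predU1P[|xs]; [by left|right].
    have : cone [set` s] x by exact: sub_cone.
    by rewrite sN.
  move=> xs; rewrite mem_cat => /orP[|/allpairsP[[p q] /= []]].
    by rewrite mem_filter => /andP[ua uN]; case: xs => [->//|]; exact.
  rewrite !mem_filter => /andP[pa pN] /andP[qa qN] ->.
  rewrite dotDl dotNl !dotZl; case: xs => [->|xs].
    by rewrite mulrC subrr.
  rewrite subr_ge0 (@le_trans _ _ 0) //.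
    by apply: mulr_le0_ge0; [exact: ltW|exact: xs].
  by apply: mulr_ge0; [exact: ltW|exact: xs].
(* The inequality w.(x - t a) >= 0 bounds t by [g w], from below if w.a < 0 and from above if w.a >
   0. The chosen t is the largest of 0 and the lower bounds; the inequalities [f u w] put it under
   the upper ones. *)
pose g w := dot w x / dot w a.
have [t [t0 tge tle]] : exists t, [/\ 0 <= t,
    forall w, w \in N -> dot w a < 0 -> g w <= t
  & forall u, u \in N -> 0 < dot u a -> t <= g u].
  have [] := @seq_argmin R _ (fun r => - r)
    (0 :: [seq g w | w <- N & dot w a < 0]) isT.
  move=> t; rewrite inE => tin tmax; exists t; split.
  - by have := tmax 0; rewrite mem_head oppr0 oppr_le0; exact.
  - move=> w wN wa; rewrite -lerN2; apply: tmax; rewrite inE; apply/orP; right.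
    by apply: map_f; rewrite mem_filter wa.
  move=> u uN ua; rewrite ler_pdivlMr //; case/orP: tin => [/eqP->|].
    by rewrite mul0r hx // mem_cat mem_filter uN ltW.
  move=> /mapP[w]; rewrite mem_filter => /andP[wa wN] ->.
  have : 0 <= dot (f u w) x.
    apply: hx; rewrite mem_cat; apply/orP; right.
    apply/allpairsP; exists (u, w).
    by rewrite !mem_filter ua wa uN wN.
  rewrite dotDl dotNl !dotZl subr_ge0 => h.
  by rewrite /g mulrAC ler_ndivrMr // mulrC (mulrC (dot w x)).
suff hy : cone [set` s] (x - t *: a).
  rewrite -(subrK (t *: a) x); apply: coneD.
    apply: cone_min hy; [exact: cone0|by move=> *; exact: coneD|
      by move=> *; exact: coneZ|].
    by move=> y ys; apply: sub_cone => /=; rewrite inE ys orbT.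
  by apply: coneZ => //; apply: sub_cone; rewrite /= mem_head.
rewrite sN => u uN; rewrite dotDr dotNr dotZr subr_ge0.
case: (ltrgt0P (dot u a)) => ua.
- by rewrite -ler_pdivlMr ?tle.
- by rewrite -ler_ndivrMr ?tge.
- by rewrite ua mulr0 hx // mem_cat mem_filter ua lexx uN.
Qed.

End Cone.

(** * Topology, and relative interiors of polyhedral cones *)

(** For each [K i] in turn, either the open set minus [K i] is nonempty and replaces it, or the open
    set already lies in [K i]. *)
Lemma shrink_open (T : topologicalType) (I : eqType) (s : seq I)
    (K : I -> set T) (W : set T) :
  (forall i, closed (K i)) -> open W -> W !=set0 ->
  exists W' : set T, [/\ open W', W' !=set0, W' `<=` W
    & forall i, i \in s -> W' `<=` K i \/ W' `<=` ~` K i].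
Proof.
move=> Kcl; elim: s W => [|i s IH] W Wo W0; first by exists W; split.
pose W1 := W `&` ~` K i.
have [[x W1x]|/forallNP W1e] := pselect (exists x, W1 x).
  have oW1 : open W1 by apply: openI => //; exact/closed_openC/Kcl.
  have [W' [oW' W'0 sW' hW']] := IH W1 oW1 (ex_intro _ x W1x).
  exists W'; split=> // [y /sW'[]//|j].
  by rewrite inE => /predU1P[->|/hW'//]; right=> y /sW'[].
have [W' [oW' W'0 sW' hW']] := IH W Wo W0.
exists W'; split=> // j; rewrite inE => /predU1P[->|/hW'//]; left=> y W'y.
by apply: contrapT => nK; apply: (W1e y); split=> //; exact: sW'.
Qed.

Section Topology.
Variables (R : realType) (d : nat).
Local Notation V := 'rV[R]_d.
Implicit Types (A C K U W : set V) (u w x y a v : V) (N s : seq V).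

Lemma dot_continuous u : continuous (dot u).
Proof.
have h := @continuous_big R 'I_d +%R 0 xpredT (@add_continuous R) V
  (index_enum 'I_d) (fun i x => u 0 i * x 0 i).
change (continuous (fun x : V => \sum_(i in 'I_d) u 0 i * x 0 i)).
apply: h => i _ x.
apply: (@continuousM _ _ (fun=> u 0 i) (fun x : V => x 0 i)).
  exact: cst_continuous.
exact: coord_continuous.
Qed.

Lemma closed_halfspaces (N : set V) :
  closed [set x : V | forall u, N u -> 0 <= dot u x].
Proof.
have -> : [set x : V | forall u, N u -> 0 <= dot u x] =
  \bigcap_(u in N) (dot u @^-1` [set r | 0 <= r]) by [].
apply: closed_bigI => u _; have /continuous_closedP := @dot_continuous u.
by apply; exact: closed_ge.
Qed.

Lemma nbhs_segment U x v : nbhs x U ->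
  exists2 e : R, 0 < e & forall t, 0 <= t <= e -> U (x + t *: v).
Proof.
move=> Ux.
have cf : (fun s : R => x + s *: v) @ (0 : R) --> x + 0 *: v.
  by apply: cvgD; [exact: cvg_cst|exact: cvgZr_tmp].
have /nbhs_ballP[e /= e0 he] : nbhs (0 : R) [set s | U (x + s *: v)].
  by apply: cf; rewrite scale0r addr0.
exists (e / 2); first by rewrite divr_gt0.
move=> s /andP[s0 se]; apply: he; rewrite /ball /= sub0r normrN ger0_norm //.
by rewrite (le_lt_trans se) // ltr_pdivrMr // ltr_pMr // ltr1n.
Qed.

(** A midpoint attains the bound [b] only if both ends do. Averaging with a point where [u] is below
    [b] thus makes [u] slack and creates no new equality. *)
Lemma relint_point K N (b : R) :
  (forall x y, K x -> K y -> K (2^-1 *: (x + y))) -> K !=set0 ->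
  (forall u x, u \in N -> K x -> dot u x <= b) ->
  exists2 x, K x & forall u, u \in N -> dot u x = b ->
    forall y, K y -> dot u y = b.
Proof.
move=> Kmid [x0 Kx0]; elim: N => [|u N IH] hN; first by exists x0.
have [|x Kx hx] := IH.
  by move=> w y wN Ky; apply: hN => //; rewrite inE wN orbT.
have le w y : w \in u :: N -> K y -> dot w y <= b by exact: hN.
have [|/existsNP[y /not_implyP[Ky uy]]] :=
    pselect (forall y, K y -> dot u y = b).
  move=> hu; exists x => // w; rewrite inE => /predU1P[->//|]; exact: hx.
have uyb : dot u y < b by rewrite lt_neqAle hN ?mem_head // andbT; exact/eqP.
have avg w : dot w (2^-1 *: (x + y)) = (dot w x + dot w y) / 2.
  by rewrite dotZr dotDr mulrC.
exists (2^-1 *: (x + y)); first exact: Kmid.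
move=> w; rewrite avg inE => /predU1P[->|wN] e.
  have := hN _ _ (mem_head u N) Kx; lra.
apply: hx => //.
have := hN w x; rewrite inE wN orbT => /(_ isT Kx).
have := hN w y; rewrite inE wN orbT => /(_ isT Ky).
lra.
Qed.

Lemma polyhedral_coneD C x y : polyhedral_cone C -> C x -> C y -> C (x + y).
Proof.
by move=> [N _ ->] Cx Cy u uN; rewrite dotDr addr_ge0 ?Cx ?Cy.
Qed.

Lemma polyhedral_coneZ C k x : polyhedral_cone C -> 0 <= k -> C x -> C (k *: x).
Proof. by move=> [N _ ->] k0 Cx u uN; rewrite dotZr mulr_ge0 ?Cx. Qed.

Lemma polyhedral_cone_relint C : polyhedral_cone C ->
  exists2 x, C x & forall F, face C F -> F x -> F = C.
Proof.
move=> pC; have [N /finite_seqP[s Ns] CE] := pC.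
have C0 : C 0 by rewrite CE => u _ /=; rewrite dot0r.
have [x y Cx Cy||w x|x Cx hx] :=
  @relint_point C [seq - u | u <- s] 0.
- by apply: polyhedral_coneZ => //; exact: polyhedral_coneD.
- by exists 0.
- move=> /mapP[u us ->]; rewrite CE => /(_ u).
  by rewrite Ns => /(_ us); rewrite dotNl oppr_le0.
exists x => // F [u [b [hb ->]]] [_ /= ux].
(* A bound attained at [x] is 0, since [C] contains 0 and 2x. *)
have b0 : b = 0.
  apply/le_anti/andP; split; last by have := hb _ C0; rewrite dot0r.
  have /hb : C (2 *: x) by exact: polyhedral_coneZ.
  by rewrite dotZr ux; lra.
apply/seteqP; split=> [y []//|y Cy]; split=> //=.
(* From [x] one can move away from [y] and stay in [C]: a constraint positive at [y] is slack at
   [x]. The functional is then <= 0 on both sides of [x], hence 0 at [y]. *)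
have [e e0 he] : exists2 e : R, 0 < e & C (x - e *: y).
  pose g w := dot w x / dot w y.
  have [e e0 he] : exists2 e : R, 0 < e &
      forall w, w \in s -> 0 < dot w y -> e <= g w.
    have [L0|/(seq_argmin g)[t]] := eqVneq [seq w <- s | 0 < dot w y] [::].
      exists 1 => // w ws wy.
      have : w \in [seq w <- s | 0 < dot w y] by rewrite mem_filter wy.
      by rewrite L0.
    rewrite mem_filter => /andP[ty ts] tmin; exists (g t).
      apply: divr_gt0 => //; rewrite lt0r.
      have -> : 0 <= dot t x by move: Cx; rewrite CE; apply; rewrite Ns.
      rewrite andbT; apply/eqP => tx.
      have := hx (- t) (map_f _ ts); rewrite dotNl tx oppr0 => /(_ erefl _ Cy).
      by rewrite dotNl; lra.
    by move=> w ws wy; apply: tmin; rewrite mem_filter wy.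
  exists e => //; rewrite CE => w; rewrite Ns => ws.
  have := Cx; rewrite CE => /(_ w); rewrite Ns => /(_ ws) wx0.
  rewrite dotDr dotNr dotZr subr_ge0; have [wy|wy] := ltP 0 (dot w y).
    by rewrite -ler_pdivlMr // he.
  by apply: le_trans wx0; rewrite pmulr_rle0.
rewrite b0 in hb ux *; apply/le_anti/andP; split; first exact: hb.
have := hb _ he; rewrite dotDr dotNr dotZr ux add0r oppr_le0.
by rewrite pmulr_rge0.
Qed.

Lemma continuous_homothety (k : R) a : continuous (fun x => k *: (x - a)).
Proof.
move=> x; apply: (@cvgZl_tmp _ _ _ (nbhs x) _ k (fun y => y - a) (x - a)).
apply: (@cvgB _ _ _ (nbhs x) _ id (cst a)); first exact: cvg_id.
exact: cvg_cst.
Qed.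

(* The homothety of centre y and ratio s maps a neighborhood of a
   into the convex set C. *)
Lemma polyhedral_cone_closure C a : polyhedral_cone C -> interior C a ->
  forall y W, C y -> nbhs y W ->
  exists W', [/\ open W', W' !=set0, W' `<=` W & W' `<=` interior C].
Proof.
move=> pC Ca y W Cy Wy.
have [e e0 he] := nbhs_segment (a - y) (nbhs_interior Wy).
pose s := Num.min e 1; have s0 : 0 < s by rewrite lt_min e0 /=.
have s1 : s <= 1 by rewrite ge_min lexx orbT.
exists (W° `&` C°); split; [|exists (y + s *: (a - y)); split| |].
- by apply: openI; exact: open_interior.
- by apply: he; rewrite ltW //= ge_min lexx.
(* [f] inverts the homothety, and z = (1 - s) y + s f(z) lies in [C] as soon as f(z) does. *)
- pose f (z : V) := s^-1 *: (z - (1 - s) *: y).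
  have fz : f (y + s *: (a - y)) = a.
    by apply/rowP => i; rewrite !mxE; field; rewrite gt_eqF.
  have cf : continuous f by exact: continuous_homothety.
  have : nbhs (y + s *: (a - y)) (f @^-1` C) by apply: cf; rewrite fz.
  apply: filterS => z /= Cfz.
  have -> : z = (1 - s) *: y + s *: f z.
    by rewrite /f scalerA mulfV ?gt_eqF // scale1r addrC subrK.
  by apply: polyhedral_coneD => //; apply: polyhedral_coneZ;
    rewrite ?subr_ge0 // ltW.
- by move=> z [/interior_subset].
- by move=> z [].
Qed.

End Topology.

(** * Half-space description of polytopes and exit points of rays *)

Section Polytope.
Variables (R : realType) (d : nat).
Local Notation V := 'rV[R]_d.
Implicit Types (A F P : set V) (u x y a v : V) (s : seq V).

Lemma conv_dot_le A u (b : R) :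
  (forall x, A x -> dot u x <= b) -> forall x, conv A x -> dot u x <= b.
Proof.
move=> h x [n [v [l [Av l0 l1 ->]]]]; rewrite dot_sumr.
rewrite -[leRHS]mul1r -l1 mulr_suml; apply: ler_sum => i _.
by apply: ler_wpM2l => //; exact: h.
Qed.

Lemma sub_conv A : A `<=` conv A.
Proof.
move=> x Ax; exists 1%N, (fun=> x), (fun=> 1); split=> //.
  by rewrite big_ord1.
by rewrite big_ord1 scale1r.
Qed.

(** The slacks 1 - u.v_i, weighted by [l], are nonnegative and sum to 0, so each term vanishes. *)
Lemma tight_coef A u n (v : 'I_n -> V) (l : 'I_n -> R) :
  (forall x, A x -> dot u x <= 1) ->
  (forall i, A (v i)) -> (forall i, 0 <= l i) -> \sum_i l i = 1 ->
  dot u (\sum_i l i *: v i) = 1 -> forall i, l i = 0 \/ dot u (v i) = 1.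
Proof.
move=> hA Av l0 l1; rewrite dot_sumr => e i.
have : \sum_i l i * (1 - dot u (v i)) = 0.
  under eq_bigr do rewrite mulrBr mulr1.
  by rewrite sumrB l1 e subrr.
move/psumr_eq0P => /(_ _ i isT) h.
have /eqP : l i * (1 - dot u (v i)) = 0.
  by apply: h => j _; rewrite mulr_ge0 // subr_ge0; exact: hA.
by rewrite mulf_eq0 subr_eq0 => /orP[/eqP|/eqP/esym]; [left|right].
Qed.

(** Besides 0, [P] contains e u for some e > 0, and there the functional takes the value e (u.u). *)
Lemma interior0_dot P u (b : R) : interior P 0 ->
  (forall x, P x -> dot u x <= b) -> 0 <= b /\ (b = 0 -> u = 0).
Proof.
move=> P0 h; split=> [|b0].
  by rewrite -(dot0r u) h //; exact: (interior_subset P0).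
apply/eqP; apply: contraT => /dot_gt0 uu.
have [e e0 /(_ e)] := nbhs_segment u P0.
rewrite lexx ltW //= => /(_ isT); rewrite add0r => /h.
by rewrite dotZr b0 leNgt mulr_gt0.
Qed.

Lemma dot_row_mx (w : 'rV[R]_(d + 1)) x :
  dot w (row_mx x 1%:M) = dot (lsubmx w) x + w 0 (rshift d 0).
Proof.
rewrite /dot big_split_ord big_ord1 /= row_mxEr mxE eqxx mulr1.
by congr +%R; apply: eq_bigr => i _; rewrite row_mxEl mxE.
Qed.

(* Homogenization: x is in the convex hull of s iff (x, 1) is in the cone
   over s x {1}. *)
Lemma polytope_halfspaces s : interior (conv [set` s]) 0 ->
  exists N : seq V, conv [set` s] = [set x | forall u, u \in N -> dot u x <= 1].
Proof.
set P := conv _ => P0.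
pose h x : 'rV[R]_(d + 1) := row_mx x 1%:M.
have [N sN] := finite_cone_halfspaces [seq h a | a <- s].
have PE x : P x <-> forall w, w \in N -> 0 <= dot w (h x).
  have -> : (forall w, w \in N -> 0 <= dot w (h x)) =
    cone [set` [seq h a | a <- s]] (h x) by rewrite sN.
  split=> [[n [v [l [sv l0 l1 ->]]]]|[n [v [l [sv l0 e]]]]].
    exists n, (h \o v), l; split=> // [i|]; first exact: map_f (sv i).
    apply/rowP => j; rewrite summxE; case: (splitP j) => i ji.
      have -> : j = lshift 1 i by exact: val_inj.
      rewrite row_mxEl summxE; apply: eq_bigr => k _.
      by rewrite !mxE (unsplitK (inl i)) /=.
    have -> : j = rshift d i by exact: val_inj.
    rewrite row_mxEr mxE (ord1 i) eqxx -l1; apply: eq_bigr => k _.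
    by rewrite mxE row_mxEr mxE eqxx mulr1.
  exists n, (lsubmx \o v), l; split=> // [i||].
  - by rewrite /=; have /mapP[a sa ->] := sv i; rewrite row_mxKl.
  - have := congr1 (fun z : 'rV_(d + 1) => z 0 (rshift d 0)) e.
    rewrite row_mxEr mxE eqxx summxE => e1; apply: etrans (esym e1).
    apply: eq_bigr => i _.
    by have /mapP[a sa ->] := sv i; rewrite mxE row_mxEr mxE eqxx mulr1.
  - have := congr1 lsubmx e; rewrite row_mxKl linear_sum => ->.
    by apply: eq_bigr => i _; rewrite linearZ.
pose b (w : 'rV[R]_(d + 1)) := w 0 (rshift d 0).
have bN w : w \in N -> 0 <= b w /\ (b w = 0 -> lsubmx w = 0).
  move=> wN; have [|b0 bl] := @interior0_dot P (- lsubmx w) (b w) P0.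
    move=> x /PE/(_ w wN); rewrite dot_row_mx dotNl /b; lra.
  by split=> // /bl/eqP; rewrite oppr_eq0 => /eqP.
(* Dividing by the constant term normalizes each inequality. Where that term is 0 the inequality is
   trivial, and [0^-1 = 0] turns it into 0 <= 1. *)
exists [seq - (b w)^-1 *: lsubmx w | w <- N].
apply/seteqP; split=> [x /PE hx u /mapP[w wN ->]|x hx].
  have := hx w wN; rewrite dot_row_mx dotZl -/(b w).
  have [bw _] := bN w wN; have [->|b0] := eqVneq (b w) 0.
    by rewrite invr0 oppr0 mul0r ler01.
  rewrite mulNr mulrC -mulNr ler_pdivrMr ?lt0r ?b0 // mul1r; lra.
apply/PE => w wN; have [bw bw0] := bN w wN; rewrite dot_row_mx -/(b w).
have [b0|b0] := eqVneq (b w) 0; first by rewrite bw0 // b0 dot0l addr0.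
have := hx _ (map_f _ wN); rewrite dotZl.
rewrite mulNr mulrC -mulNr ler_pdivrMr ?lt0r ?b0 // mul1r; lra.
Qed.

(** Ratio test: the ray leaves at the least (1 - u.p) / (u.v) over the constraints with u.v > 0.
    There is such a constraint, because the hull is bounded in direction [v]. *)
Lemma exit_point s (N : seq V) p v :
  conv [set` s] = [set x | forall u, u \in N -> dot u x <= 1] ->
  conv [set` s] p -> v != 0 ->
  exists t u, [/\ conv [set` s] (p + t *: v), u \in N,
    dot u (p + t *: v) = 1, 0 < dot u v &
    forall e, conv [set` s] (p + e *: v) -> e <= t].
Proof.
move=> PN Pp v0.
have [M sM] : exists M : R, forall a, a \in s -> dot v a <= M.
  have [->|/(seq_argmin (dot (- v)))[a _ ha]] := eqVneq s [::].
    by exists 0.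
  by exists (dot v a) => x /ha; rewrite !dotNl lerN2.
have PM := conv_dot_le sM.
have N0 : [seq u <- N | 0 < dot u v] != [::].
  apply/eqP => L0; pose t : R := (M - dot v p + 1) / dot v v.
  have t0 : 0 <= t.
    by rewrite divr_ge0 ?(ltW (dot_gt0 v0)) //; have := PM _ Pp; lra.
  have : conv [set` s] (p + t *: v).
    rewrite PN => u uN; rewrite dotDr dotZr.
    have : u \notin [seq u <- N | 0 < dot u v] by rewrite L0.
    rewrite mem_filter uN andbT -leNgt => uv.
    by have := Pp; rewrite PN => /(_ u uN); have := mulr_ge0_le0 t0 uv; lra.
  move/PM; rewrite dotDr dotZr /t divfK ?gt_eqF ?dot_gt0 //; lra.
have [u] := seq_argmin (fun u => (1 - dot u p) / dot u v) N0.
rewrite mem_filter => /andP[uv uN] umin.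
exists ((1 - dot u p) / dot u v), u.
have e1 : dot u (p + ((1 - dot u p) / dot u v) *: v) = 1.
  by rewrite dotDr dotZr divfK ?gt_eqF // addrC subrK.
split=> // [|e].
  rewrite PN => w wN; have := Pp; rewrite PN => Pp'.
  rewrite dotDr dotZr -lerBrDl; have [wv|wv] := ltP 0 (dot w v).
    by rewrite -ler_pdivlMr // umin // mem_filter wv.
  rewrite (@le_trans _ _ 0) ?subr_ge0 ?Pp' //; apply: mulr_ge0_le0 => //.
  by apply: divr_ge0; [rewrite subr_ge0 Pp'|exact: ltW].
by rewrite PN => /(_ u uN); rewrite dotDr dotZr ler_pdivlMr // lerBrDl.
Qed.

End Polytope.

(** * Facets and their normals *)

Lemma count_lt (T : eqType) (p q : pred T) (s : seq T) a :
  (forall x, x \in s -> p x -> q x) -> a \in s -> q a -> ~~ p a ->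
  (count p s < count q s)%N.
Proof.
move=> pq sa qa pa.
have -> : (count q s = count p s + count (predD q p) s)%N.
  elim: s {sa} pq => //= x s IH pq.
  rewrite IH => [|y ys]; last by apply: pq; rewrite inE ys orbT.
  have := pq x (mem_head _ _).
  by case: (p x); case: (q x) => //= h; do ?[by have := h isT|lia].
by rewrite -[ltnLHS]addn0 ltn_add2l -has_count; apply/hasP; exists a;
  rewrite //= pa.
Qed.

Section Facet.
Variables (R : realType) (d : nat).
Local Notation V := 'rV[R]_d.
Implicit Types (A F G P K : set V) (u x y a p q c w : V) (s : seq V).

Lemma aff_dot F w (b : R) : (forall x, F x -> dot w x = b) ->
  forall x, aff F x -> dot w x = b.
Proof.
move=> h x [n [v [l [Fv l1 ->]]]]; rewrite dot_sumr.
by under eq_bigr do rewrite h //; rewrite -mulr_suml l1 mul1r.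
Qed.

Lemma aff_nonempty F x : aff F x -> F !=set0.
Proof.
move=> [[|n] [v [l [Fv l1 _]]]]; last by exists (v ord0).
by move/eqP: l1; rewrite big_ord0 eq_sym oner_eq0.
Qed.

Lemma has_dim_unique A k m : has_dim A k -> has_dim A m -> k = m.
Proof.
suff le j l : has_dim A j -> has_dim A l -> (j <= l)%N.
  by move=> Ak Am; apply/eqP; rewrite eqn_leq !le.
move=> [x [U [AU <-]]] [y [W [AW <-]]]; apply/dimvS/subvP => v Uv.
have [w Ww xw] : [set y + w | w in [set w | w \in W]] (x + 0).
  by rewrite -AW AU; exists 0; rewrite //= mem0v.
have [w' Ww' xw'] : [set y + w | w in [set w | w \in W]] (x + v).
  by rewrite -AW AU; exists v.
have -> : v = x + v - (x + 0) by rewrite addr0 addrC addKr.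
by rewrite -xw -xw' opprD addrACA subrr add0r memvB.
Qed.

(** The normal is scaled to the value 1 on [F], so for a polytope around 0 it is a point of the
    polar. The last clause says that [F] spans the space linearly, and replaces the condition on
    dimension. *)
Definition facet_normal P F u : Prop :=
  [/\ F !=set0, forall x, P x -> dot u x <= 1,
      F = P `&` [set x | dot u x = 1]
    & forall w, (forall x, F x -> dot w x = 0) -> w = 0].

Lemma facet_facet_normal P F : full_dimensional P -> interior P 0 ->
  facet P F -> exists u, facet_normal P F u.
Proof.
move=> Pd P0 [[u [b [hb FE]]] [k Fk Pk]].
have dk := has_dim_unique Pd Pk.
have [b0 bu] := interior0_dot P0 hb.
have {}b0 : 0 < b.
  (* With b = 0 the functional would be 0 and [F] all of [P], which has another dimension. *)
  rewrite lt0r b0 andbT; apply/eqP => e.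
  suff FP : F = P.
    by move: Fk; rewrite FP => /(has_dim_unique Pk)/eqP; rewrite gtn_eqF.
  rewrite FE; apply/seteqP; split=> [x []//|x Px]; split=> //=.
  by rewrite bu // e dot0l.
have {}FE : F = P `&` [set x | dot (b^-1 *: u) x = 1].
  rewrite FE; congr (P `&` _); apply/seteqP; split=> x /=; rewrite dotZl.
    by move=> ->; rewrite mulVf ?gt_eqF.
  by move/(congr1 ( *%R b)); rewrite mulVKf ?gt_eqF // mulr1.
have {}hb x : P x -> dot (b^-1 *: u) x <= 1.
  by move=> Px; rewrite dotZl mulrC ler_pdivrMr // mul1r hb.
move: (b^-1 *: u) hb FE => {b b0 bu}u hu FE; exists u.
have [x0 [U [FU dU]]] := Fk.
have affx0 v : v \in U -> aff F (x0 + v) by rewrite FU => Uv; exists v.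
have Fx0 : aff F x0 by rewrite -[x0]addr0; apply: affx0; rewrite mem0v.
split=> //; first exact: aff_nonempty Fx0.
have Fu : forall x, aff F x -> dot u x = 1.
  by apply: aff_dot => x; rewrite FE => -[].
move=> w /aff_dot Fw.
have wU v : v \in U -> dot w v = 0.
  by move=> /affx0/Fw; rewrite dotDr (Fw _ Fx0) add0r.
(* The hyperplane u = 1 contains [x0 + U] but not 0; so [x0] is not in [U], and adding it raises the
   dimension from [k] to [d]. *)
have x0U : x0 \notin U.
  apply/negP => /affx0/Fu; rewrite dotDr (Fu _ Fx0) => /eqP.
  by rewrite -subr_eq0 addrK oner_eq0.
have Ufull : (U + <[x0]>)%VS = fullv.
  have dV : \dim {:V} = d by rewrite dimvf dim_matrix mul1r.
  apply/eqP; rewrite eqEdim subvf dV /=; apply: leq_trans (eq_leq dk) _.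
  rewrite -dU.
  have /leqifP := dimv_leqif_sup (addvSl U <[x0]>).
  case: ifP => // /subvP/(_ x0); rewrite (negPf x0U) => h.
  have := h _; rewrite -{1}[x0]add0r memv_add ?mem0v ?memv_line //.
  by move=> /(_ isT).
apply: dot_eq0P => y.
have /memv_addP[v Uv [_ /vlineP[r ->] ->]] : y \in (U + <[x0]>)%VS.
  by rewrite Ufull memvf.
by rewrite dotDr dotZr wU // (Fw _ Fx0) mulr0 addr0.
Qed.

(** The generators on [F] span the space because [F] does, so the affine hull of [F] is the whole
    hyperplane u = 1. *)
Lemma facet_normal_facet s F u : full_dimensional (conv [set` s]) ->
  facet_normal (conv [set` s]) F u -> facet (conv [set` s]) F.
Proof.
set P := conv _ => Pd [[p0 Fp0] hu FE hw].
split; first by exists u, 1.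
have up0 : dot u p0 = 1 by move: Fp0; rewrite FE => -[].
(* The rows are the generators on [F], with 0 in place of the others. A vector orthogonal to all
   rows is orthogonal to [F], hence 0. *)
pose M := \matrix_(i < size s) if dot u s`_i == 1 then s`_i else 0.
have Mfull : row_full M.
  rewrite -cokermx_eq0; apply/eqP/matrixP => i j; rewrite [RHS]mxE.
  suff : (col j (cokermx M))^T = 0 by move/rowP/(_ i); rewrite !mxE.
  apply: hw => x; rewrite FE => -[[n [v [l [sv l0 l1 ->]]]] ux].
  rewrite dot_sumr big1 // => k _.
  have [|->|uv] := tight_coef _ sv l0 l1 ux k; first last.
  - have /(nthP 0)[m ms mv] := sv k.
    have : row (Ordinal ms) (M *m cokermx M) 0 j = 0.
      by rewrite mulmx_coker !mxE.
    rewrite row_mul rowK /= mv uv eqxx => h.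
    by rewrite dotE trmxK colE mulmxA -colE mxE h mulr0.
  - by rewrite mul0r.
  - by move=> y sy; apply: hu; exact: sub_conv.
have affF : aff F = [set y | dot u y = 1].
  apply/seteqP; split=> y; first by apply: aff_dot => x; rewrite FE => -[].
  move=> /= uy; have /submxP[D yD] := submx_full y Mfull.
  (* The coefficients of [y] on the tight generators sum to u.y = 1; each remaining slot gets the
     point [p0] with weight 0. *)
  exists (size s),
    (fun i : 'I_(size s) => if dot u s`_i == 1 then s`_i else p0),
    (fun i : 'I_(size s) => if dot u s`_i == 1 then D 0 i else 0).
  have yE : y = \sum_(i < size s) (if dot u s`_i == 1 then D 0 i else 0) *:
      (if dot u s`_i == 1 then s`_i else p0).
    rewrite yD mulmx_sum_row; apply: eq_bigr => i _.
    by rewrite rowK; case: ifP => // _; rewrite scaler0 scale0r.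
  split=> //.
    move=> i; case: ifP => // /eqP ui; rewrite FE; split=> //.
    by apply: sub_conv => /=; exact: mem_nth.
  apply: etrans uy; rewrite yE dot_sumr; apply: eq_bigr => i _.
  by case: ifP => [/eqP->|_]; rewrite ?mulr1 ?mul0r.
(* Rank-nullity for y |-> u.y, whose image is a line. *)
pose f : 'Hom(V, 'M[R]_1) := linfun (mulmxr u^T).
have fE y : f y = (dot u y)%:M by rewrite lfunE /= dotE [LHS]mx11_scalar.
have kerP y : (y \in lker f) = (dot u y == 0).
  rewrite memv_ker fE; apply/eqP/eqP => [/matrixP/(_ 0 0)|->].
    by rewrite !mxE eqxx.
  by apply/matrixP => i j; rewrite !mxE mul0rn.
exists (\dim (lker f)).
  exists p0, (lker f); split=> //; rewrite affF; apply/seteqP; split=> y /=.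
    move=> uy; exists (y - p0); last by rewrite addrC subrK.
    by rewrite /= kerP dotDr dotNr uy up0 subrr.
  by move=> [v /=]; rewrite kerP => /eqP uv <-; rewrite dotDr up0 uv addr0.
suff -> : (\dim (lker f)).+1 = d by [].
have dV : \dim {:V} = d by rewrite dimvf dim_matrix mul1r.
apply: etrans dV; have := limg_ker_dim f fullv; rewrite capfv => <-.
rewrite -addn1; congr addn; apply/eqP; rewrite eqn_leq; apply/andP; split.
  rewrite lt0n dimv_eq0; apply/eqP => f0.
  have : f p0 \in limg f by rewrite memv_img ?memvf.
  rewrite f0 memv0 fE up0 => /eqP/matrixP/(_ 0 0).
  by rewrite !mxE eqxx => /eqP; rewrite oner_eq0.
by rewrite (leq_trans (dimvS (subvf _))) // dimvf dim_matrix.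
Qed.

(* A face of maximal dimension through x: as long as the tight vertices do not
   span, the functional can be tilted until a new vertex becomes tight. *)
Lemma facet_cover s x u : interior (conv [set` s]) 0 ->
  (forall y, conv [set` s] y -> dot u y <= 1) ->
  conv [set` s] x -> dot u x = 1 ->
  exists F w, facet_normal (conv [set` s]) F w /\ F x.
Proof.
set P := conv _ => P0 + Px.
have [n] := ubnP (count (fun a => dot u a != 1) s).
elim: n u => // n IH u; rewrite ltnS => un hu ux.
pose F := P `&` [set x | dot u x = 1].
have [hF|/existsNP[w /not_implyP[wF /eqP w0]]] :=
    pselect (forall w, (forall x, F x -> dot w x = 0) -> w = 0).
  by exists F, u; split=> //; split=> //; exists x.
have wtight a : a \in s -> dot u a = 1 -> dot w a = 0.
  by move=> sa ua; apply: wF; split=> //; exact: sub_conv.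
(* If [w] were <= 0 on all generators, it would be <= 0 on a neighborhood of 0, hence zero. *)
have L0 : [seq a <- s | 0 < dot w a] != [::].
  apply: contra w0 => /eqP L0; apply/eqP.
  apply: (proj2 (interior0_dot P0 _)) erefl.
  apply: conv_dot_le => a /= sa; rewrite leNgt; apply/negP => wa.
  have : a \in [seq a <- s | 0 < dot w a] by rewrite mem_filter wa.
  by rewrite L0.
(* [r] is the least tilt that makes a new generator tight; the tight ones remain so, since [w]
   vanishes on them. *)
have [a] := seq_argmin (fun a => (1 - dot u a) / dot w a) L0.
rewrite mem_filter => /andP[wa sa] amin.
set r := (1 - dot u a) / dot w a in amin.
have us y : y \in s -> dot u y <= 1 by move=> sy; apply: hu; exact: sub_conv.
have r0 : 0 <= r by apply: divr_ge0; [rewrite subr_ge0 us|exact: ltW].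
apply: (IH (u + r *: w)).
- apply: leq_trans un; apply: (count_lt (a := a)) => //.
  + move=> y sy; apply: contra => /eqP uy.
    by rewrite dotDl dotZl uy wtight // mulr0 addr0.
  + by apply/eqP => /(wtight _ sa) e; rewrite e ltxx in wa.
  + rewrite negbK dotDl dotZl divfK; last by rewrite gt_eqF.
    by rewrite addrC subrK.
- apply: conv_dot_le => y /= sy; rewrite dotDl dotZl -lerBrDl.
  have [wy|wy] := ltP 0 (dot w y).
    by rewrite -ler_pdivlMr // amin // mem_filter wy.
  by rewrite (@le_trans _ _ 0) ?subr_ge0 ?us //; exact: mulr_ge0_le0.
- by rewrite dotDl dotZl ux wF // mulr0 addr0.
Qed.

End Facet.

(** * Bisectors and cones of differences of facets *)

Section Bisector.
Variables (R : realType) (d : nat).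
Local Notation V := 'rV[R]_d.
Implicit Types (F G P K : set V) (u x y p q a b c w : V) (t k l : R).

Definition convex_set K : Prop := forall x y k l, K x -> K y ->
  0 <= k -> 0 <= l -> k + l = 1 -> K (k *: x + l *: y).

Lemma convex_comb K x y k l : convex_set K -> K x -> K y -> 0 <= k -> 0 <= l ->
  exists2 z, K z & k *: x + l *: y = (k + l) *: z.
Proof.
move=> Kc Kx Ky k0 l0; have [|kl0] := eqVneq (k + l) 0.
  move=> /eqP; rewrite paddr_eq0 // => /andP[/eqP -> /eqP ->].
  by exists x; rewrite // !scale0r !addr0 scale0r.
exists ((k / (k + l)) *: x + (l / (k + l)) *: y).
  apply: Kc; rewrite ?divr_ge0 ?addr_ge0 //.
  by rewrite -mulrDl mulfV.
by rewrite scalerDr !scalerA !(mulrC (k + l)) !divfK.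
Qed.

Lemma convex_polar (N : seq V) :
  convex_set [set x | forall u, u \in N -> dot u x <= 1].
Proof.
move=> x y k l Nx Ny k0 l0 kl u uN; rewrite dotDr !dotZr -kl.
by apply: lerD; rewrite ler_piMr ?Nx ?Ny.
Qed.

Lemma facet_normal_convex P F u : convex_set P -> facet_normal P F u ->
  convex_set F.
Proof.
move=> Pc [_ _ -> _] x y k l [Px /= ux] [Py /= uy] k0 l0 kl; split=> /=.
  exact: Pc.
by rewrite dotDr !dotZr ux uy !mulr1.
Qed.

Lemma facet_normal_opp P F u : (forall x, P x -> P (- x)) ->
  facet_normal P F u -> facet_normal P [set x | F (- x)] (- u).
Proof.
move=> PN [[p Fp] hu FE hw]; split.
- by exists (- p); rewrite /= opprK.
- by move=> x /PN/hu; rewrite dotNr dotNl.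
- apply/seteqP; split=> x /=; rewrite FE /= dotNl dotNr.
    by move=> [/PN]; rewrite opprK.
  by move=> [/PN].
move=> w h; apply: hw => x Fx.
have := h (- x); rewrite /= opprK dotNr => /(_ Fx)/eqP.
by rewrite oppr_eq0 => /eqP.
Qed.

Lemma cone_convexE F x : convex_set F -> F !=set0 -> cone F x ->
  exists t p, [/\ 0 <= t, F p & x = t *: p].
Proof.
move=> Fc [p0 Fp0].
apply: (@cone_min _ _ F [set x | exists t p, [/\ 0 <= t, F p & x = t *: p]]).
- by exists 0, p0; rewrite scale0r.
- move=> _ _ [t [p [t0 Fp ->]]] [k [q [k0 Fq ->]]].
  have [z Fz ->] := convex_comb Fc Fp Fq t0 k0.
  by exists (t + k), z; rewrite addr_ge0.
- move=> k _ k0 [t [p [t0 Fp ->]]].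
  by exists (k * t), p; rewrite mulr_ge0 // scalerA.
- by move=> p Fp; exists 1, p; rewrite ler01 scale1r.
Qed.

(** If b - a = k q with q in [P], pairing with [u] gives t = k (u.q) <= k. *)
Lemma dist_facet P F u a b t p : facet_normal P F u -> 0 <= t -> F p ->
  b - a = t *: p -> dist P a b = t.
Proof.
move=> [_ hu FE _] t0 Fp e.
have [Pp up] : P p /\ dot u p = 1 by move: Fp; rewrite FE.
have lbt : lbound [set k : R | 0 <= k /\ [set k *: q | q in P] (b - a)] t.
  move=> k [k0 [q Pq]]; rewrite e => /(congr1 (dot u)).
  by rewrite !dotZr up mulr1 => <-; rewrite ler_piMr // hu.
have tin : [set k : R | 0 <= k /\ [set k *: q | q in P] (b - a)] t.
  by split=> //; exists p.
apply/le_anti/andP; split; first by apply: ge_inf => //; exists t.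
by apply: lb_le_inf => //; exists t.
Qed.

(** The cone K_{F,G}. *)
Definition diff_cone F G : set V :=
  [set c | exists t p q, [/\ 0 <= t, F p, G q & c = t *: (p - q)]].

(** A point x of the left side has x = t p and x - c = k q. The scalars are its distances to 0 and
    [c], so they agree and c = t (p - q). Conversely, x = t p is such a point. *)
Lemma bis_facetsP P F G u w c : convex_set P ->
  facet_normal P F u -> facet_normal P G w ->
  bis_facets P F G 0 c !=set0 <-> diff_cone F G c.
Proof.
move=> Pc FP GP; have [F0 _ _ _] := FP; have [G0 _ _ _] := GP.
split=> [[x [[xbis [y Fy yx]] [z Gz zx]]]|[t [p [q [t0 Fp Gq ->]]]]].
  have [t [p [t0 Fp yE]]] := cone_convexE (facet_normal_convex Pc FP) F0 Fy.
  have [k [q [k0 Gq zE]]] := cone_convexE (facet_normal_convex Pc GP) G0 Gz.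
  have dt : dist P 0 x = t.
    by apply: dist_facet FP t0 Fp _; rewrite subr0 -yx addr0.
  have dk : dist P c x = k.
    by apply: dist_facet GP k0 Gq _; rewrite -zx addrK.
  exists t, p, q; split=> //.
  have tk : k = t by rewrite -dk -dt.
  by rewrite scalerBr -yE -tk -zE -[y]addr0 yx -zx addrC addKr.
exists (t *: p); split; first split.
- rewrite /bis /= (dist_facet FP t0 Fp) ?subr0 //.
  by rewrite (dist_facet GP t0 Gq) // scalerBr opprB addrC subrK.
- by exists (t *: p); rewrite ?addr0 //; apply: coneZ => //; exact: sub_cone.
- exists (t *: q); first by apply: coneZ => //; exact: sub_cone.
  by rewrite scalerBr addrC subrK.
Qed.

(** F - (-F) = F + F, and t p = (t/2) (p - (-p)). *)
Lemma diff_cone_opp F : convex_set F -> F !=set0 ->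
  diff_cone F [set x | F (- x)] = cone F.
Proof.
move=> Fc F0; apply/seteqP; split=> x.
  move=> [t [p [q [t0 Fp Fq ->]]]]; apply: coneZ => //.
  by apply: coneD; exact: sub_cone.
move=> /(cone_convexE Fc F0)[t [p [t0 Fp ->]]].
exists (t / 2), p, (- p); rewrite /= opprK divr_ge0 //; split=> //.
by rewrite scalerDr -scalerDl -splitr.
Qed.

End Bisector.

(** * General position and equivalence classes for a symmetric polytope *)

Section Polytope_bisector.
Variables (R : realType) (d : nat) (s : seq 'rV[R]_d).
Local Notation V := 'rV[R]_d.
Local Notation P := (conv [set` s]).
Hypothesis P0 : interior P 0.
Hypothesis Pd : full_dimensional P.
Hypothesis PN : forall x, P x -> P (- x).
Implicit Types (F G : set V) (u x y p q a b c w : V) (t k l : R).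

Lemma polytope_convex : convex_set P.
Proof. by have [N ->] := polytope_halfspaces P0; exact: convex_polar. Qed.

(** Masks mark the generators on two facets; with lengths fixed to [size s] they index a finite
    family of cones. *)
Definition mask_cone (m1 m2 : bitseq) : set V :=
  cone [set` [seq a - b | a <- mask m1 s, b <- mask m2 s]].

Lemma closed_mask_cone m1 m2 : closed (mask_cone m1 m2).
Proof.
rewrite /mask_cone; have [N ->] := finite_cone_halfspaces
  [seq a - b | a <- mask m1 s, b <- mask m2 s].
exact: (@closed_halfspaces _ _ [set` N]).
Qed.

(** A point of a facet is a convex combination of the generators on it; expanding both points writes
    p - q through differences of generators. *)
Lemma diff_cone_mask F G u w : facet_normal P F u -> facet_normal P G w ->
  diff_cone F G = mask_cone (map (fun a => dot u a == 1) s)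
                            (map (fun b => dot w b == 1) s).
Proof.
move=> FP GP; rewrite /mask_cone -!filter_mask; set K := cone _.
have [[p0 Fp0] hu FE _] := FP; have [[q0 Gq0] hw GE _] := GP.
have Fc := facet_normal_convex polytope_convex FP.
have Gc := facet_normal_convex polytope_convex GP.
apply/seteqP; split=> [_ [t [p [q [t0 Fp Gq ->]]]]|].
  apply: coneZ => //.
  have KF b : b \in s -> dot w b = 1 -> K (p - b).
    move=> bs wb; have := Fp; rewrite FE => -[[n [v [l [sv l0 l1 ->]]]] /= up].
    have -> : \sum_i l i *: v i - b = \sum_i l i *: (v i - b).
      under [RHS]eq_bigr do rewrite scalerBr.
      by rewrite sumrB -scaler_suml l1 scale1r.
    apply: (big_ind K) => [|x y|i _]; [exact: cone0|exact: coneD|].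
    have [y /sub_conv/hu|->|uv] // := tight_coef _ sv l0 l1 up i.
      by rewrite scale0r; exact: cone0.
    apply: coneZ => //; apply: sub_cone; apply/allpairsP; exists (v i, b).
    by rewrite !mem_filter uv wb eqxx bs; split=> //; exact: sv.
  have := Gq; rewrite GE => -[[n [v [l [sv l0 l1 ->]]]] /= wq].
  have -> : p - \sum_i l i *: v i = \sum_i l i *: (p - v i).
    under [RHS]eq_bigr do rewrite scalerBr.
    by rewrite sumrB -scaler_suml l1 scale1r.
  apply: (big_ind K) => [|x y|i _]; [exact: cone0|exact: coneD|].
  have [y /sub_conv/hw|->|wv] // := tight_coef _ sv l0 l1 wq i.
    by rewrite scale0r; exact: cone0.
  by apply: coneZ => //; apply: KF => //; exact: sv.
apply: cone_min.
- by exists 0, p0, q0; rewrite scale0r.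
- move=> _ _ [t [p [q [t0 Fp Gq ->]]]] [t' [p' [q' [t'0 Fp' Gq' ->]]]].
  have [p1 Fp1 p1E] := convex_comb Fc Fp Fp' t0 t'0.
  have [q1 Gq1 q1E] := convex_comb Gc Gq Gq' t0 t'0.
  exists (t + t'), p1, q1; rewrite addr_ge0 //; split=> //.
  by rewrite !scalerBr -p1E -q1E opprD addrACA.
- move=> k _ k0 [t [p [q [t0 Fp Gq ->]]]].
  by exists (k * t), p, q; rewrite mulr_ge0 // scalerA.
- move=> _ /allpairsP[[a b] [/= + + ->]]; rewrite !mem_filter.
  move=> /andP[/eqP ua sa] /andP[/eqP wb sb]; exists 1, a, b.
  rewrite ler01 scale1r FE GE; split=> //; split=> //; exact: sub_conv.
Qed.

(** [W] contains a nonempty open set on which membership in each of the finitely many cones is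
    constant. *)
Lemma general_position_dense (W : set V) : open W -> W !=set0 ->
  exists2 c, W c & general_position P c.
Proof.
move=> Wo W0.
pose e := enum {: (size s).-tuple bool * (size s).-tuple bool}.
have [W' [W'o [c W'c] sW' hW']] := @shrink_open V _ e
  (fun i => mask_cone i.1 i.2) W (fun i => @closed_mask_cone _ _) Wo W0.
exists c; first exact: sW'.
exists W'; first exact: open_nbhs_nbhs.
move=> c' W'c' F G /(facet_facet_normal Pd P0)[u FP].
move=> /(facet_facet_normal Pd P0)[w GP].
rewrite !(bis_facetsP _ polytope_convex FP GP) (diff_cone_mask FP GP).
have /= [|h|h] := hW' (map_tuple (fun a => dot u a == 1) (in_tuple s),
                    map_tuple (fun b => dot w b == 1) (in_tuple s)).
- by rewrite /e mem_enum.
- by split=> _; apply: h.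
- by split=> /h; [move/(_ W'c)|move/(_ W'c')].
Qed.

(** The ray from 0 through [x] leaves the polytope at a point of some facet. *)
Lemma facet_cone_cover x : x != 0 ->
  exists F u, facet_normal P F u /\ cone F x.
Proof.
move=> x0; have [N PE] := polytope_halfspaces P0.
have P00 : P 0 := interior_subset P0.
have [t [u [Pt uN ut _ tmax]]] := exit_point PE P00 x0.
have hu y : P y -> dot u y <= 1 by rewrite PE; apply.
have [F [w [FP Ft]]] := facet_cover P0 hu Pt ut.
exists F, w; split=> //; rewrite add0r in Ft ut.
have t0 : t != 0.
  apply/eqP => t0; move/eqP: ut.
  by rewrite t0 scale0r dot0r eq_sym oner_eq0.
rewrite -[x]scale1r -(mulVf t0) -scalerA; apply: coneZ; last exact: sub_cone.
by rewrite invr_ge0; apply: tmax; rewrite scale0r addr0.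
Qed.

(* Leaving P from a relative interior point of F in the direction -b, one
   reaches some facet G, and then b lies in the cone of F - G. *)
Lemma facet_side_diff_cone F u b : facet_normal P F u -> 0 < dot u b ->
  exists G w, facet_normal P G w /\ diff_cone F G b.
Proof.
move=> FP ub; have [F0 hu FE hw] := FP; have [N PE] := polytope_halfspaces P0.
have b0 : - b != 0.
  by rewrite oppr_eq0; apply: contraTN ub => /eqP ->; rewrite dot0r ltxx.
have [x y Fx Fy||v x vN|p Fp pN] := @relint_point _ _ F N 1.
- rewrite scalerDr; apply: (facet_normal_convex polytope_convex FP) => //.
  by lra.
- exact: F0.
- by rewrite FE PE => -[+ _]; apply.
have [Pp up] : P p /\ dot u p = 1 by move: Fp; rewrite {1}FE.
have [t [v [Pt vN vt vb tmax]]] := exit_point PE Pp b0.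
have hv y : P y -> dot v y <= 1 by rewrite PE; apply.
have [G [w [GP Gt]]] := facet_cover P0 hv Pt vt.
exists G, w; split=> //.
have t_ge0 : 0 <= t by apply: tmax; rewrite scale0r addr0.
(* If t = 0, then [v] is tight at [p], hence on all of [F], so v = u because [F] spans. But v.(-b) >
   0 and u.b > 0. *)
have t0 : t != 0.
  apply/eqP => t0; rewrite t0 scale0r addr0 in vt.
  suff vu : v - u = 0 by move: vb; rewrite (subr0_eq vu) dotNr; lra.
  apply: hw => x Fx; rewrite dotDl dotNl (pN v vN vt x Fx).
  by move: Fx; rewrite FE => -[_ /= ->]; rewrite subrr.
exists t^-1, p, (p + t *: - b); rewrite invr_ge0; split=> //.
by rewrite opprD addrA subrr add0r -scalerN opprK scalerA mulVf // scale1r.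
Qed.

Lemma bis_equiv_side F u b b' : facet_normal P F u -> bis_equiv P 0 b 0 b' ->
  0 < dot u b -> 0 <= dot u b'.
Proof.
move=> FP bb' ub; have [G [w [GP FGb]]] := facet_side_diff_cone FP ub.
have [_ hu FE _] := FP; have [_ _ GE _] := GP.
have : diff_cone F G b'.
  apply/(bis_facetsP _ polytope_convex FP GP).
  by apply/bb'; [exact: facet_normal_facet FP|exact: facet_normal_facet GP|];
    apply/(bis_facetsP _ polytope_convex FP GP).
move=> [t [p [q [t0 Fp Gq ->]]]].
rewrite dotZr dotDr dotNr mulr_ge0 // subr_ge0.
have -> : dot u p = 1 by move: Fp; rewrite FE => -[].
by apply: hu; move: Gq; rewrite GE => -[].
Qed.

(** If u.c = 0, small moves from [c] along [u] and [- u] would give equivalent points strictly on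
    opposite sides. *)
Lemma general_position_off F u c : facet_normal P F u -> general_position P c ->
  dot u c != 0.
Proof.
move=> FP [U Uc hU]; apply/eqP => uc.
have u0 : u != 0.
  have [[p]] := FP; move=> + _ FE _; rewrite FE => -[_ /= up].
  by apply: contra_eqT up => /negPn/eqP ->; rewrite dot0l eq_sym oner_eq0.
have [e e0 /(_ e)] := nbhs_segment u Uc; rewrite lexx ltW // => /(_ isT) Ue.
have [k k0 /(_ k)] := nbhs_segment (- u) Uc; rewrite lexx ltW // => /(_ isT) Uk.
have : 0 <= dot u (c + k *: - u).
  apply: (@bis_equiv_side F u (c + e *: u)) => //.
    move=> G H Gf Hf; have := hU _ Ue G H Gf Hf; have := hU _ Uk G H Gf Hf.
    by move=> h1 h2; split=> [/h2/h1|/h1/h2].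
  by rewrite dotDr uc add0r dotZr mulr_gt0 // dot_gt0.
rewrite dotDr uc add0r scalerN dotNr dotZr oppr_ge0 leNgt.
by rewrite mulr_gt0 // dot_gt0.
Qed.

Lemma bis_equiv_sg F u a b : facet_normal P F u ->
  general_position P a -> general_position P b -> bis_equiv P 0 a 0 b ->
  Num.sg (dot u a) = Num.sg (dot u b).
Proof.
move=> FP /(general_position_off FP) a0 /(general_position_off FP) b0 ab.
case: (ltrgt0P (dot u a)) a0 => // ua _.
  by rewrite !gtr0_sg // lt0r b0 (bis_equiv_side FP ab).
(* The negative case is the positive one for the opposite facet, with normal [- u]. *)
rewrite !ltr0_sg // lt_neqAle b0 -oppr_ge0 -dotNl.
by apply: (bis_equiv_side (facet_normal_opp PN FP) ab); rewrite dotNl oppr_gt0.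
Qed.

Lemma closed_facet_cone F u : facet_normal P F u -> closed (cone F).
Proof.
move=> FP; have [F0 _ _ _] := FP.
rewrite -(diff_cone_opp (facet_normal_convex polytope_convex FP) F0).
rewrite (diff_cone_mask FP (facet_normal_opp PN FP)).
exact: closed_mask_cone.
Qed.

Lemma bis_equiv_facet_cone F u a b : facet_normal P F u ->
  bis_equiv P 0 a 0 b -> cone F a -> cone F b.
Proof.
move=> FP ab; have [F0 _ _ _] := FP; have FN := facet_normal_opp PN FP.
rewrite -(diff_cone_opp (facet_normal_convex polytope_convex FP) F0).
move=> /(bis_facetsP _ polytope_convex FP FN) h.
apply/(bis_facetsP _ polytope_convex FP FN).
by apply/ab => //; [exact: facet_normal_facet FP|exact: facet_normal_facet FN].
Qed.

(** Reduces both refinements to one class: a closed condition shared by all points equivalent to [a]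
    passes to [C]. *)
Lemma bisection_fan_cone Delta C : bisection_fan P Delta -> Delta C ->
  exists2 a, general_position P a &
    C `<=` closure [set b | general_position P b /\ bis_equiv P 0 a 0 b].
Proof.
move=> [[Dfin Dpoly _ Dface] Dbis] DC.
have [x Cx xface] := polyhedral_cone_relint (Dpoly _ DC).
pose M := [set D | maximal_cone Delta D /\
  exists2 a, general_position P a & interior D a].
have [D [Dmax [a ga Da]] Dx] : (\bigcup_(D in M) D) x.
  have cM : closed (\bigcup_(D in M) D).
    apply: closed_bigcup => [|D [[DD _] _]].
      by apply: sub_finite_set Dfin => D [[]].
    by have [N _ ->] := Dpoly _ DD; exact: closed_halfspaces.
  (* Otherwise some [c] in general position avoids the union. Being equivalent to itself, [c] is
     interior to a maximal cone, which belongs to [M]. *)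
  apply: contrapT => nx.
  have [|c nc gc] := general_position_dense (closed_openC cM).
    by exists x.
  have [D [Dmax Dc _]] := (Dbis c c gc gc).1 (fun _ _ _ _ => conj id id).
  by apply: nc; exists D; [split=> //; exists c|exact: interior_subset].
(* The intersection with [D] is a face of [C] through the relative interior point [x], hence all of
   [C]. *)
have CD : C `<=` D.
  have [/xface CDC _] := Dface _ _ DC Dmax.1.
  by rewrite -CDC //; move=> y [].
exists a => // y /CD Dy B By.
have [W [oW W0 sWB sWD]] := polyhedral_cone_closure (Dpoly _ Dmax.1) Da Dy By.
have [c Wc gc] := general_position_dense oW W0.
exists c; split; last exact: sWB.
split=> //; apply/(Dbis a c ga gc); exists D; split=> //; last exact: sWD.
Qed.

End Polytope_bisector.

(** * Refinement of the hyperplane fan and the face fan *)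

Theorem proposition3p7 (R : realType) (d : nat) (P : set 'rV[R]_d)
    (Delta : set (set 'rV[R]_d)) :
  polytope P -> full_dimensional P -> centrally_symmetric P ->
  interior P 0 ->
  bisection_fan P Delta ->
  refined_by (facet_hyperplane_fan P) Delta /\
  refined_by (face_fan P) Delta.
Proof.
move=> [A /finite_seqP[s ->] ->] {A P} + + P0 DP.
set P := conv _ in P0 DP * => Pd Psym.
have PN x : P x -> P (- x) by move=> Px; rewrite -Psym; exists x.
split=> C DC; have [a ga Ca] := bisection_fan_cone P0 Pd DP DC.
  exists (closure (cell (facet_arrangement P) a)); first by exists a.
  apply: subset_trans Ca (closureS _) => b [gb ab] u.
  move=> [_ [F [_ _ /(facet_facet_normal Pd P0)[f FP] uF]]].
  have [[p Fp] _ FE fann] := FP.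
  (* [u] is constant on [F], so this difference vanishes on [F], which spans; thus [u] is a multiple
     of [f], and the sign of [f] decides. *)
  have uf : u - dot u p *: f = 0.
    apply: fann => x Fx; rewrite dotDl dotNl dotZl.
    have := Fx; rewrite FE => -[_ /= ->].
    by have := uF x p Fx Fp; rewrite /hyperplane /= dotDr dotNr mulr1.
  rewrite (subr0_eq uf) !dotZl !sgrM; congr (_ * _); apply/esym.
  exact: (bis_equiv_sg P0 Pd PN FP ga gb ab).
(* If the space is {0} there are no facets, and the cone of the empty face is used. *)
have [[x x0]|V0] := pselect (exists x : 'rV[R]_d, x != 0); last first.
  exists (cone set0).
    exists set0 => //; split; last first.
      by split=> // /(_ 0); apply; exact: (interior_subset P0).
    exists 0, 1; split=> [x _|]; first by rewrite dot0l ler01.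
    apply/seteqP; split=> // x [_ /=]; rewrite dot0l => /eqP.
    by rewrite eq_sym oner_eq0.
  move=> x _; suff -> : x = 0 by exact: cone0.
  by apply/eqP/negPn/negP => x0; apply: V0; exists x.
have [F [u [FP Fa]]] : exists F u, facet_normal P F u /\ cone F a.
  (* The point 0 lies in every facet cone, and the nonzero [x] provides a facet. *)
  have [->|a0] := eqVneq a 0; last exact: (facet_cone_cover P0 a0).
  have [F [u [FP _]]] := facet_cone_cover P0 x0.
  by exists F, u; split=> //; exact: cone0.
exists (cone F).
  exists F => //; split; first by have [] := facet_normal_facet Pd FP.
  have [_ _ -> _] := FP; split=> [y []//|/(_ 0 (interior_subset P0))[_ /=]].
  by rewrite dot0r => /esym/eqP; rewrite oner_eq0.
rewrite (iffLR (closure_id _) (closed_facet_cone P0 PN FP)).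
apply: subset_trans Ca (closureS _) => b [_ ab].
exact: (bis_equiv_facet_cone P0 Pd PN FP ab).
Qed.
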